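(* For every unbounded function $\rho:\mathbb{N}\to\mathbb{N}$ there is a $C'(\frac16)$ small cancellation presentation $G=\langle a,b,c,d\mid r_1,r_2,\ldots\rangle$ such that the map $\mathbb{Z}\to\mathrm{Cay}(G,\{a,b,c,d\})$ given by $n\mapsto b^n$ is an isometric embedding and $p_i\cdot\mathrm{sat}_b(r_i)\preceq\rho(i)$ (where $p_i$ is the length of the longest piece in $r_i$), but $b$ is not a generalized loxodromic element of $G$.
   Context: An action of a group $G$ by isometries on a metric space $X$ is acylindrical if for all $d\ge 0$ there exist constants $M,N\ge 0$ such that for all $x,y\in X$ with $d(x,y)\ge M$, the number of elements $g\in G$ satisfying $d(x,gx)\le d$ and $d(y,gy)\le d$ is at most $N$. An element $g\in G$ is generalized loxodromic if there is an acylindrical action of $G$ on a (Gromov) hyperbolic space $X$ such that $g$ acts loxodromically. $F(S)$ is the free group on $S$, whose elements are regarded as reduced words. Let $R\subset F(S)\setminus\{1\}$ consist of cyclically reduced elements and be closed under taking inverses and cyclic conjugates. For $\lambda\in(0,1)$, $R$ satisfies the $C'(\lambda)$ small cancellation condition if for any distinct $r,r'\in R$ with reduced decompositions $r=us$ and $r'=us'$ one has $|u|<\lambda|r|$. A word $u$ arising as such a common initial subword of two distinct elements of $R$ is called a piece; a piece in $r$ is a piece that occurs as a subword of a cyclic conjugate of $r^{\pm1}$. A presentation $\langle S\mid r_1,r_2,\ldots\rangle$ with cyclically reduced relators is $C'(\lambda)$ if the set $R$ of all cyclic conjugates of the $r_i$ and their inverses satisfies $C'(\lambda)$, and pieces are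 taken with respect to this $R$. Given words $v,w\in F(S)$ with $v$ cyclically reduced, the $w$-saturation of $v$ is $\mathrm{sat}_w(v)=k/|v|_S$, where $k$ is the largest number of letters in a cyclic conjugate of $v$ which can be covered by (not necessarily disjoint) copies of cyclically reduced conjugates of the word $w$. For functions $f,\rho$, write $f(i)\preceq\rho(i)$ if there is a constant $C$ such that $f(i)\le C\rho(i)+C$ for all $i$. $\mathrm{Cay}(G,S)$ is the Cayley graph with its path metric. *)

(* Defs.v *)
From HB Require Import structures.
From mathcomp Require Import all_boot all_order all_algebra generic_quotient.
From mathcomp Require Import boolp classical_sets functions cardinality reals.
From mathcomp Require Import topology.

Set Implicit Arguments.
Unset Strict Implicit.
Unset Printing Implicit Defensive.

Import Order.TTheory GRing.Theory Num.Theory.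

Local Open Scope classical_set_scope.
Local Open Scope quotient_scope.

Section FreeGroup.
Variable S : choiceType.

Local Notation letter := (S * bool)%type.
Implicit Types (x y : letter) (u v w : seq letter).

(* [(s, false)] is the letter s and [(s, true)] the letter s^-1. *)
Definition linv x : letter := (x.1, ~~ x.2).

Definition no_cancel : rel letter := fun x y => y != linv x.

Definition reduced w := sorted no_cancel w.

Record freegrp := FreeGrp { fword :> seq letter; _ : reduced fword }.
HB.instance Definition _ := [isSub for fword].
HB.instance Definition _ := [Choice of freegrp by <:].

(* Left multiplication of a reduced word by one letter, with cancellation. *)
Definition lmul x w :=
  if w is y :: w' then (if y == linv x then w' else x :: w) else [:: x].

Definition wmul u v := foldr lmul v u.
Definition winv u := rev (map linv u).

Lemma linvK : involutive linv.
Proof. by case=> s e; rewrite /linv /= negbK. Qed.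

Lemma winvK : involutive winv.
Proof. by move=> u; rewrite /winv map_rev revK mapK //; exact: linvK. Qed.

Lemma reduced_tail x w : reduced (x :: w) -> reduced w.
Proof. exact: path_sorted. Qed.

Lemma reduced_lmul x w : reduced w -> reduced (lmul x w).
Proof.
case: w => [|y w] //= rw; case: eqVneq => [_|yx]; first exact: path_sorted rw.
by rewrite /reduced /= /no_cancel yx.
Qed.

Lemma reduced_wmul u v : reduced v -> reduced (wmul u v).
Proof. by move=> rv; elim: u => //= x u; exact: reduced_lmul. Qed.

Lemma lmul_red x w : reduced (x :: w) -> lmul x w = x :: w.
Proof.
by case: w => [|y w] //= /andP[]; rewrite /no_cancel => /negbTE ->.
Qed.

Lemma lmulK x w : reduced w -> lmul x (lmul (linv x) w) = w.
Proof.
case: w => [|y w] rw /=; first by rewrite eqxx.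
rewrite linvK; case: eqVneq => [yx|yx] /=; last by rewrite eqxx.
by rewrite -yx; exact: lmul_red.
Qed.

Lemma wmul_lmul x u w : reduced w -> wmul (lmul x u) w = lmul x (wmul u w).
Proof.
case: u => [|y u] //= rw; case: eqVneq => [->|_] //=.
by rewrite lmulK //; exact: reduced_wmul.
Qed.

Lemma wmulA u v w : reduced w -> wmul u (wmul v w) = wmul (wmul u v) w.
Proof. by move=> rw; elim: u => //= x u ->; rewrite wmul_lmul. Qed.

Lemma wmul1 u : reduced u -> wmul u [::] = u.
Proof.
elim: u => //= x u IHu rxu.
by rewrite IHu ?lmul_red //; exact: reduced_tail rxu.
Qed.

Lemma wmulV u : wmul (winv u) u = [::].
Proof.
elim: u => //= x u IHu.
by rewrite /winv /= rev_cons -cats1 /wmul foldr_cat /= linvK eqxx.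
Qed.

Lemma reduced_winv u : reduced u -> reduced (winv u).
Proof.
rewrite /reduced /winv rev_sorted sorted_map; apply: sub_sorted => x y.
by apply: contraNneq => xy; rewrite [linv x]xy linvK.
Qed.

Definition fone := @FreeGrp [::] isT.
Definition finv (u : freegrp) := FreeGrp (reduced_winv (valP u)).
Definition fmul (u v : freegrp) := FreeGrp (reduced_wmul u (valP v)).

Fact fmulA : associative fmul.
Proof. by move=> u v w; apply/val_inj; rewrite /= wmulA //; exact: valP. Qed.
Fact fmul1g : left_id fone fmul.
Proof. by move=> u; exact/val_inj. Qed.
Fact fmulg1 : right_id fone fmul.
Proof. by move=> u; apply/val_inj/wmul1/(valP u). Qed.
Fact fmulVg : left_inverse fone finv fmul.
Proof. by move=> u; apply/val_inj/wmulV. Qed.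
Fact fmulgV : right_inverse fone finv fmul.
Proof.
by move=> u; apply/val_inj; rewrite /= -[X in wmul X _]winvK wmulV.
Qed.

HB.instance Definition _ :=
  isGroup.Build freegrp fmulA fmul1g fmulg1 fmulVg fmulgV.

Definition fgen (s : S) : freegrp := @FreeGrp [:: (s, false)] isT.

(* On top of reducedness, [cycle] compares the last letter with the first. *)
Definition cyc_reduced w := cycle no_cancel w.

Definition cyc_conjugate (u v : freegrp) := exists k, fword v = rot k u.

End FreeGroup.

Arguments fgen {S} s.

Section NormalClosure.
Variable F : groupType.
Local Open Scope group_scope.

Definition normal_subgroup (N : set F) :=
  [/\ N 1, forall x y, N x -> N y -> N (x / y) & forall x g, N x -> N (x ^ g)].

Definition normal_closure (A : set F) : set F :=
  [set x | forall N, normal_subgroup N -> A `<=` N -> N x].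

Lemma normal_closureP A : normal_subgroup (normal_closure A).
Proof.
split=> [N [] //|x y nx ny N nN AN|x g nx N nN AN].
  by case: (nN) => _ + _; apply; [exact: nx|exact: ny].
by case: (nN) => _ _; apply; exact: nx.
Qed.

Variable A : set F.

Definition nc_eq : rel F := fun x y => `[< normal_closure A (x / y) >].

Let nc1 : normal_closure A 1.
Proof. by case: (normal_closureP A). Qed.
Let ncF x y : normal_closure A x -> normal_closure A y ->
  normal_closure A (x / y).
Proof. by case: (normal_closureP A) => _ + _; apply. Qed.
Let ncV x : normal_closure A x -> normal_closure A x^-1.
Proof. by move=> nx; rewrite -[x^-1]mul1g; exact: ncF. Qed.
Let ncM x y : normal_closure A x -> normal_closure A y ->
  normal_closure A (x * y).
Proof. by move=> nx ny; rewrite -[y]invgK; apply: ncF => //; exact: ncV. Qed.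
Let ncJ x g : normal_closure A x -> normal_closure A (x ^ g).
Proof. by case: (normal_closureP A) => _ _; apply. Qed.

Fact nc_eq_refl : reflexive nc_eq.
Proof. by move=> x; apply/asboolP; rewrite mulgV. Qed.
Fact nc_eq_sym : symmetric nc_eq.
Proof.
by move=> x y; apply/asboolP/asboolP => /ncV; rewrite invgF.
Qed.
Fact nc_eq_trans : transitive nc_eq.
Proof.
move=> y x z /asboolP xy /asboolP yz; apply/asboolP.
by have := ncM xy yz; rewrite mulgA mulgVK.
Qed.

Canonical nc_equiv := EquivRel nc_eq nc_eq_refl nc_eq_sym nc_eq_trans.

Definition quot_nc : Type := {eq_quot nc_equiv}.
HB.instance Definition _ := Choice.on quot_nc.

Definition qpi (x : F) : quot_nc := \pi_({eq_quot nc_equiv}) x.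
Definition qrepr (x : quot_nc) : F := repr (x : {eq_quot nc_equiv}).

Lemma qreprK : cancel qrepr qpi.
Proof. exact: reprK. Qed.

Lemma qpiP x y : qpi x = qpi y <-> normal_closure A (x / y).
Proof.
split=> [/(@eqquotP _ nc_equiv)/asboolP //|nxy].
exact/(@eqquotP _ nc_equiv)/asboolP.
Qed.

Definition qone := qpi 1.
Definition qmul x y := qpi (qrepr x * qrepr y).
Definition qinv x := qpi (qrepr x)^-1.

Lemma qpiM x y : qpi (x * y) = qmul (qpi x) (qpi y).
Proof.
have /qpiP ex := qreprK (qpi x); have /qpiP ey := qreprK (qpi y).
apply/esym/qpiP.
have -> : qrepr (qpi x) * qrepr (qpi y) / (x * y)
  = (qrepr (qpi y) / y) ^ (qrepr (qpi x))^-1 * (qrepr (qpi x) / x).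
  by rewrite /conjg invgM invgK !mulgA mulgVK.
by apply: ncM => //; exact: ncJ.
Qed.

Lemma qpiV x : qpi x^-1 = qinv (qpi x).
Proof.
have /qpiP ex := qreprK (qpi x); apply/qpiP.
rewrite invgK; have := ncJ x ex.
by rewrite /conjg mulgVK.
Qed.

Fact qmulA : associative qmul.
Proof.
move=> x y z; rewrite -(qreprK x) -(qreprK y) -(qreprK z).
by rewrite -!qpiM mulgA.
Qed.
Fact qmul1g : left_id qone qmul.
Proof. by move=> x; rewrite -(qreprK x) -qpiM mul1g. Qed.
Fact qmulg1 : right_id qone qmul.
Proof. by move=> x; rewrite -(qreprK x) -qpiM mulg1. Qed.
Fact qmulVg : left_inverse qone qinv qmul.
Proof. by move=> x; rewrite -(qreprK x) -qpiV -qpiM mulVg. Qed.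
Fact qmulgV : right_inverse qone qinv qmul.
Proof. by move=> x; rewrite -(qreprK x) -qpiV -qpiM mulgV. Qed.

HB.instance Definition _ :=
  isGroup.Build quot_nc qmulA qmul1g qmulg1 qmulVg qmulgV.

End NormalClosure.

Definition presented (S : choiceType) (r : nat -> freegrp S) : groupType :=
  quot_nc (range r).

Definition pgen (S : choiceType) (r : nat -> freegrp S) (s : S) : presented r :=
  qpi (range r) (fgen s).

Arguments pgen {S} r s.

Definition expgz (G : groupType) (x : G) (n : int) : G :=
  match n with Posz k => (x ^+ k)%g | Negz k => (x ^- k.+1)%g end.

Section Cayley.
Variables (S : choiceType) (r : nat -> freegrp S).
Local Open Scope group_scope.
Let G : groupType := presented r.
Implicit Types g h : G.

Definition cay_adj : rel G :=
  fun g h => `[< exists s, h = g * pgen r s \/ g = h * pgen r s >].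

Definition cay_walk g h (n : nat) : bool :=
  `[< exists p : seq G, [/\ path cay_adj g p, last g p = h & size p = n] >].

Lemma cay_connected g h : exists n, cay_walk g h n.
Proof.
have [x ->] : exists x, h = g * qpi (range r) x.
  by exists (qrepr (g^-1 * h)); rewrite qreprK mulVKg.
case: x => w rw; elim: w rw g => [|[s e] w IHw] rw g.
  exists 0%N; apply/asboolP; exists [::]; split=> //=.
  by rewrite -[LHS]mulg1; congr (_ * qpi _ _); exact/val_inj.
have rw' := reduced_tail rw.
pose l : freegrp S := @FreeGrp S [:: (s, e)] isT.
have -> : FreeGrp rw = l * FreeGrp rw'.
  by apply/val_inj; rewrite /= lmul_red.
have -> : qpi (range r) (l * FreeGrp rw')
  = qpi (range r) l * qpi (range r) (FreeGrp rw') :> G by exact: qpiM.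
rewrite mulgA; have [_ /asboolP[p [pp pl _]]] := IHw rw' (g * qpi (range r) l).
exists (size p).+1; apply/asboolP; exists (g * qpi (range r) l :: p).
split=> //=; rewrite pp andbT {p pp pl}; apply/asboolP; exists s; rewrite /pgen.
case: {rw rw'} e @l => l; [right|left].
  rewrite -mulgA -[LHS]mulg1; congr (_ * _).
  rewrite -[RHS](qpiM (range r)); congr (qpi _ _); apply/val_inj => /=.
  by rewrite /linv /= eqxx.
by congr (_ * qpi _ _); exact/val_inj.
Qed.

(* The path metric of the Cayley graph, restricted to the vertices. *)
Definition cay_dist g h : nat := ex_minn (cay_connected g h).

End Cayley.

Section SmallCancellation.
Variables (R : realType) (S : choiceType).
Local Notation F := (freegrp S).
Implicit Types (A : set F) (u v w : F).

Definition symmetrized (r : nat -> F) : set F :=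
  [set x | exists i, cyc_conjugate (r i) x \/ cyc_conjugate (r i)^-1%g x].

Definition piece A (u : seq (S * bool)) :=
  exists x y, [/\ A x, A y, x <> y, prefix u x & prefix u y].

Definition small_cancellation (lam : R) A :=
  forall x y (u : seq (S * bool)), A x -> A y -> x <> y ->
    prefix u x -> prefix u y -> ((size u)%:R < lam * (size x)%:R)%R.

Definition small_cancellation_presentation (lam : R) (r : nat -> F) :=
  (forall i, r i <> 1%g /\ cyc_reduced (r i)) /\
  small_cancellation lam (symmetrized r).

Definition piece_in A (x : F) (u : seq (S * bool)) :=
  piece A u /\
  exists y : F, (cyc_conjugate x y \/ cyc_conjugate x^-1%g y) /\ infix u y.

(* The bound loses nothing: a subword of a cyclic conjugate of x or x^-1 has
   length at most |x|. *)
Definition longest_piece A (x : F) : nat :=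
  \max_(n < (size x).+1 |
      `[< exists u : seq (S * bool), piece_in A x u /\ size u = n >]) n.

(* Position [i] of [v] lies in a copy of a cyclically reduced conjugate of
   [w]; conjugates of w^-1 do not count. *)
Definition covered w (v : seq (S * bool)) (i : nat) : bool :=
  `[< exists (g : F) (x y : seq (S * bool)),
      [/\ cyc_reduced (w ^ g)%g, v = x ++ (w ^ g)%g ++ y
        & (size x <= i < size x + size (w ^ g)%g)%N] >].

Definition ncovered w (v : seq (S * bool)) : nat :=
  #|[pred i : 'I_(size v) | covered w v i]|.

Definition sat w v : R :=
  ((\max_(j < size v) ncovered w (rot j v))%:R / (size v)%:R)%R.

Definition preceq (f rho : nat -> R) :=
  exists C : R, forall i, (f i <= C * rho i + C)%R.

End SmallCancellation.

Section Hyperbolic.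
Variables (R : realType) (X : metricType R).
Local Open Scope ring_scope.
Implicit Types (x y z : X) (p q : R -> X).

Definition geodesic x y p :=
  [/\ p 0 = x, p (mdist x y) = y
    & forall s t, 0 <= s <= mdist x y -> 0 <= t <= mdist x y ->
        mdist (p s) (p t) = `|s - t|].

Definition geodesic_space := forall x y, exists p, geodesic x y p.

(* Permuting x, y, z cyclically gives the condition for the other two sides. *)
Definition slim_triangles (delta : R) :=
  forall x y z p q q', geodesic x y p -> geodesic y z q -> geodesic z x q' ->
  forall t, 0 <= t <= mdist x y ->
    (exists2 s, 0 <= s <= mdist y z & mdist (p t) (q s) <= delta) \/
    (exists2 s, 0 <= s <= mdist z x & mdist (p t) (q' s) <= delta).

Definition hyperbolic_space :=
  geodesic_space /\ exists delta, slim_triangles delta.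

Variable G : groupType.

Definition isometric_action (act : G -> X -> X) :=
  [/\ forall x, act 1%g x = x,
      forall g h x, act (g * h)%g x = act g (act h x)
    & forall g x y, mdist (act g x) (act g y) = mdist x y].

Definition acylindrical (act : G -> X -> X) :=
  forall d : R, 0 <= d -> exists (M : R) (N : nat), 0 <= M /\
    forall x y, M <= mdist x y ->
      ([set g | mdist x (act g x) <= d /\ mdist y (act g y) <= d]
         #<= `I_N)%card.

(* The orbit map n |-> g^n x of some point x is a quasi-isometric embedding of
   the integers; the choice of x is irrelevant. *)
Definition loxodromic (act : G -> X -> X) (g : G) :=
  exists (x : X) (L K : R), [/\ 1 <= L, 0 <= K & forall m n : int,
    let D := `|m - n|%:~R in
    L^-1 * D - K <= mdist (act (expgz g m) x) (act (expgz g n) x) <= L * D + K].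

End Hyperbolic.

Definition generalized_loxodromic (R : realType) (G : groupType) (g : G) :=
  exists (X : metricType R) (act : G -> X -> X),
    [/\ hyperbolic_space X, isometric_action act, acylindrical act
      & loxodromic act g].

Variant abcd := gen_a | gen_b | gen_c | gen_d.

Definition ord_of_abcd x : 'I_4 :=
  match x with
  | gen_a => inord 0 | gen_b => inord 1 | gen_c => inord 2 | gen_d => inord 3
  end.
Definition abcd_of_ord (i : 'I_4) :=
  match val i with 0 => gen_a | 1 => gen_b | 2 => gen_c | _ => gen_d end.
Lemma ord_of_abcdK : cancel ord_of_abcd abcd_of_ord.
Proof. by case; rewrite /abcd_of_ord /= inordK. Qed.
HB.instance Definition _ := Finite.copy abcd (can_type ord_of_abcdK).

(* Main.v *)
Require Import Defs.
From mathcomp Require Import all_boot all_order all_algebra.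
From mathcomp Require Import boolp classical_sets reals.
From mathcomp Require Import functions cardinality topology.
From mathcomp Require Import zify ring lra.

(** The relators are
      R_n = prod over w in {c,d}^3 of
            b^n (a w c) b^-n (a w d) b^n (a^-1 w c) b^-n (a^-1 w d),
    and r_i is R_n for n = rho(i) + 1; values of rho may repeat, and so may the
    relators.  The 32 connectors a^+-1 w c, a^+-1 w d between the powers of b do
    not depend on n.

    C'(1/6).  The connectors are distinct words of length 5 without b, so a
    subword that contains a full power b^n between two connectors determines n
    and its position in the relator.  A piece is thus shorter than three of the
    32 blocks of the relator ([common_prefix_unique],
    [relators_small_cancellation]).

    b is not generalized loxodromic.  Suppose that b is loxodromic in an
    acylindrical action on a hyperbolic space.  The relation R_n = 1 is a closed
    path made of long quasigeodesics b^n, b^-n, joined by short connectors.  Such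
    a path closes up only if it backtracks at some connector x, by an amount that
    tends to infinity with n ([ping_pong]).  So x moves a long part of an orbit
    of b or of its inverse by a bounded distance, pointwise, and acylindricity
    gives x b^m = b^m x for some m > 0 ([gprod_bounded]).

    This cannot happen in G ([connector_not_commute]), and b^n is at distance
    |n| from 1 ([cay_dist_powers]); both facts are seen in a quotient of G.  Map
    b to the shift of the lamplighter group Z wr Z, map a to a lamp generator, and
    c, d to 1.  In R_n the lamps are changed at two positions only, and each
    position receives as many a as a^-1, so R_n maps to 1; but a lamp does not
    commute with a power of the shift, and the exponent sum of b is a
    1-Lipschitz function on the Cayley graph.

    The bound on p_i sat_b(r_i) holds because |r_i| = 32 (rho(i) + 6). *)

Set Implicit Arguments.
Unset Strict Implicit.
Unset Printing Implicit Defensive.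

Import Order.TTheory GRing.Theory Num.Theory.
Local Open Scope ring_scope.

(** * Hyperbolicity and Gromov products *)

Section GromovProduct.
Context {R : realType} {X : metricType R}.
Implicit Types o x y z : X.

Definition gprod o x y : R := (mdist o x + mdist o y - mdist x y) / 2.

(** Gromov's condition (x|z)_o >= min ((x|y)_o, (y|z)_o) - e, as a disjunction
    so that it can be used by case analysis. *)
Definition four_point (e : R) := forall o x y z,
  gprod o x y <= gprod o x z + e \/ gprod o y z <= gprod o x z + e.

Lemma gprodC o x y : gprod o x y = gprod o y x.
Proof. by rewrite /gprod [mdist x y]metric_sym; lra. Qed.

Lemma gprod_lip o x y o' x' y' :
  gprod o x y <= gprod o' x' y' + mdist o o' + mdist x x' + mdist y y'.
Proof.
have := (metric_triangle o o' x, metric_triangle o' x' x).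
have := (metric_triangle o o' y, metric_triangle o' y' y).
have := (metric_triangle x' x y', metric_triangle x y y').
rewrite [mdist x' x]metric_sym [mdist y' y]metric_sym.
by rewrite /gprod => -[? ?] [? ?] [? ?]; lra.
Qed.

Lemma gprod_le o x y : gprod o x y <= mdist o x.
Proof.
by have := metric_triangle o x y; rewrite /gprod; lra.
Qed.

Lemma geodesicE x y p t : geodesic x y p -> 0 <= t <= mdist x y ->
  mdist x (p t) = t /\ mdist (p t) y = mdist x y - t.
Proof.
move=> [p0 p1 pm] /andP[t0 t1]; have xy0 := mdist_ge0 x y.
rewrite -{1}p0 -{1}p1 !pm ?lexx ?xy0 ?t0 ?t1 // sub0r normrN.
by rewrite ger0_norm // distrC ger0_norm ?subr_ge0.
Qed.

Lemma gprod_le_geodesic o x y p t : geodesic x y p -> 0 <= t <= mdist x y ->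
  gprod o x y <= mdist o (p t).
Proof.
move=> gp tb; have [e1 e2] := geodesicE gp tb.
have := (metric_triangle o (p t) x, metric_triangle o (p t) y).
rewrite [mdist (p t) x]metric_sym e1 e2 /gprod => -[? ?]; lra.
Qed.

Lemma last_true (P : nat -> Prop) n : P 0%N -> ~ P n ->
  exists k, P k /\ ~ P k.+1.
Proof.
move=> P0; elim: n => [//|n IHn] Pn.
by have [Pn'|/IHn//] := pselect (P n); exists n.
Qed.

(** A point of the side [x, y] that is close to both other sides of the triangle
    o, x, y realizes the Gromov product (x|y)_o up to a constant.  Such a point
    is found by walking along [x, y] in unit steps and stopping the last time
    the side [o, x] is within reach; the next step is near [y, o] or past y.
    The latter alternative puts the point within 1 of y. *)
Lemma slim_center {delta : R} o x y p :
  geodesic_space X -> slim_triangles X delta -> 0 <= delta -> geodesic x y p ->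
  exists2 t : R, 0 <= t <= mdist x y &
    mdist o (p t) <= gprod o x y + 2 * (delta + 1).
Proof.
move=> geo slim d0 gp; have [q gq] := geo y o; have [q' gq'] := geo o x.
pose P k := k%:R <= mdist x y /\
  exists2 s : R, 0 <= s <= mdist o x & mdist (p k%:R) (q' s) <= delta.
have [k [[kx [s' sb' ks']] nk]] : exists k, P k /\ ~ P k.+1.
  apply: (@last_true _ (Num.bound (mdist x y))).
    split; first exact: mdist_ge0.
    exists (mdist o x); first by rewrite mdist_ge0 lexx.
    by case: gp gq' => -> _ _ [_ -> _]; rewrite mdistxx.
  by move=> [+ _]; apply/negP; rewrite -ltNge archi_boundP // mdist_ge0.
have kb : (0 : R) <= k%:R <= mdist x y by rewrite ler0n kx.
have [s sb ks] : exists2 s : R, 0 <= s <= mdist y o &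
    mdist (p k%:R) (q s) <= delta + 1.
  have [kx1|kx1] := leP k.+1%:R (mdist x y); last first.
    exists 0; first by rewrite lexx mdist_ge0.
    case: gq => -> _ _; have [_ ->] := geodesicE gp kb.
    by move: kx1; rewrite -natr1; lra.
  have kb1 : (0 : R) <= k.+1%:R <= mdist x y by rewrite ler0n kx1.
  have [[s sb ks]|k1] := slim x y o p q q' gp gq gq' _ kb1; last first.
    by case: nk.
  exists s => //; apply: (le_trans (metric_triangle _ (p k.+1%:R) _)).
  rewrite addrC lerD //; case: gp => _ _ -> //.
  by rewrite -natr1 opprD addrA subrr sub0r normrN1.
exists k%:R => //; have [e1 e2] := geodesicE gp kb.
have [e3 e4] := geodesicE gq sb; have [e5 e6] := geodesicE gq' sb'.
have := metric_triangle o (q' s') (p k%:R).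
have := metric_triangle o (q s) (p k%:R).
have := metric_triangle y (q s) (p k%:R).
have := metric_triangle (p k%:R) (q' s') x.
rewrite /gprod [mdist (q' s') (p _)]metric_sym [mdist (q s) (p _)]metric_sym.
rewrite [mdist y (p _)]metric_sym [mdist (p _) x]metric_sym.
rewrite [mdist o (q s)]metric_sym [mdist o y]metric_sym.
by move=> ? ? ? ?; lra.
Qed.

(** The center of the triangle o, x, z on [x, z] is close to [x, y] or [y, z],
    and a point of [x, y] is at distance at least (x|y)_o from o. *)
Lemma hyperbolic_four_point : hyperbolic_space X ->
  exists2 e : R, 0 <= e & four_point e.
Proof.
move=> [geo [delta' slim']]; pose delta := Num.max 0 delta'.
have d0 : 0 <= delta by rewrite /delta le_max lexx.
have dd : delta' <= delta by rewrite /delta le_max lexx orbT.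
have slim : slim_triangles X delta.
  move=> x y z p q q' gp gq gq' t tb.
  have [[s sb ts]|[s sb ts]] := slim' x y z p q q' gp gq gq' t tb.
    by left; exists s => //; exact: le_trans dd.
  by right; exists s => //; exact: le_trans dd.
exists (2 * (delta + 1) + delta) => [|o x y z]; first lra.
have [p gp] := geo x z; have [q gq] := geo z y; have [q' gq'] := geo y x.
have [t tb ot] := slim_center o geo slim d0 gp.
have [[s sb ts]|[s sb ts]] := slim x z y p q q' gp gq gq' t tb.
  right; rewrite gprodC; have := gprod_le_geodesic o gq sb.
  by have := metric_triangle o (p t) (q s); lra.
left; rewrite gprodC; have := gprod_le_geodesic o gq' sb.
by have := metric_triangle o (p t) (q' s); lra.
Qed.

End GromovProduct.

(** * Displacement of the powers of an isometry *)

Section Displacement.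
(** [f n] stands for the distance from o to b^n o.  The hypothesis [f4] is the
    four-point condition for o, b^i o, b^(i+j) o, b^(i+j+k) o. *)
Context {R : realType} (f : nat -> R) (e L K : R).
Hypotheses (e_ge0 : 0 <= e) (f0 : f 0%N = 0) (f_ge0 : forall n, 0 <= f n).
Hypothesis fD : forall m n, f (m + n)%N <= f m + f n.
Hypothesis fB : forall m n, f m <= f (m + n)%N + f n.
Hypothesis f4 : forall i j k,
  f (i + j)%N + f (j + k)%N <= f i + f k + 2 * e \/
  f (i + j)%N + f (j + k)%N <= f j + f (i + j + k)%N + 2 * e.
Hypothesis L_gt0 : 0 < L.
Hypothesis f_lin : forall n, L^-1 * n%:R - K <= f n.

Lemma displacement_le n : f n <= n%:R * f 1%N.
Proof.
elim: n => [|n IHn]; first by rewrite f0 mul0r.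
by rewrite -addn1 natrD mulrDl mul1r (le_trans (fD _ _)) // lerD2r.
Qed.

Lemma expn2_beats_linear (A B : R) : exists k, A + k%:R * B < (2 ^ k)%:R.
Proof.
pose A' := Num.max 0 A; pose B' := Num.max 0 B.
have [A0 AA] : 0 <= A' /\ A <= A' by rewrite /A' !le_max !lexx orbT.
have [B0 BB] : 0 <= B' /\ B <= B' by rewrite /B' !le_max !lexx orbT.
pose j := Num.bound (A' + 2 * B').
have Hj : A' + 2 * B' < j%:R by rewrite archi_boundP //; lra.
exists (2 * j)%N.
have H2 : (j.+1 * j.+1 <= 2 ^ (2 * j))%N.
  by rewrite mul2n -addnn expnD leq_mul // ltn_expl.
apply: (@lt_le_trans _ _ (j.+1 * j.+1)%:R); last by rewrite ler_nat.
have j0 : 0 <= j%:R :> R by [].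
rewrite !natrM -natr1; set u := j%:R in Hj j0 *.
nra.
Qed.

(** Otherwise f (2^k) would grow at most linearly in k. *)
Lemma displacement_jump C : exists m, f m + C <= f (2 * m)%N.
Proof.
apply: contrapT => /forallNP H.
have f2 k : f (2 ^ k)%N <= f 1%N + k%:R * C.
  elim: k => [|k IHk]; first by rewrite expn0 mul0r addr0.
  have /negP := H (2 ^ k)%N; rewrite -ltNge -expnS -natr1 => Hk; lra.
have [k] := expn2_beats_linear (L * (K + f 1%N)) (L * C).
apply/negP; rewrite -leNgt.
have := ler_wpM2l (ltW L_gt0) (le_trans (f_lin _) (f2 k)).
by rewrite mulrBr mulVKf ?gt_eqF //; lra.
Qed.

(** The orbit of b is a quasigeodesic whose points are uniformly close to being
    aligned.  At a scale m where f doubles with a definite gain, f increases by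
    more than e at each multiple of m: in the four-point condition for m, m and
    a m the alternative where f does not increase is excluded.  The condition
    for (a-1) m, m, (b-1) m then rules out its first alternative, and the second
    one is superadditivity along multiples of m; remainders cost a constant. *)
Lemma displacement_superadditive : exists c, forall p q,
  f p + f q <= f (p + q)%N + c.
Proof.
have e0 := e_ge0; have [m hm] := displacement_jump (3 * e + 1).
have m_gt0 : (0 < m)%N.
  by case: m hm => // hm; move: hm; rewrite muln0 f0 => hm; lra.
have step a : f (a * m)%N + e < f (a.+1 * m)%N.
  elim: a => [|a IHa].
    rewrite mul0n mul1n f0; have := fD m m; rewrite addnn -mul2n; lra.
  have := f4 m m (a * m)%N.
  rewrite addnn -mul2n -[(m + a * m)%N]/(a.+1 * m)%N.
  have -> : (2 * m + a * m = a.+2 * m)%N by lia.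
  by case=> ?; lra.
have mult a b : f (a * m)%N + f (b * m)%N <= f (a * m + b * m)%N +
    (2 * f m + 2 * e).
  have fm := f_ge0 m.
  case: a => [|a]; first by rewrite !mul0n f0 add0n; lra.
  case: b => [|b]; first by rewrite !mul0n f0 addn0; lra.
  have := f4 (a * m)%N m (b * m)%N.
  rewrite [(m + b * m)%N]addnC -!mulSnr.
  have := (step a, step b); have := fB (a.+1 * m + b * m)%N m.
  rewrite -addnA -mulSnr => ? [? ?] [] ?; lra.
exists (2 * f m + 2 * e + 4 * (m%:R * f 1%N)) => p q.
have small r : f (r %% m)%N <= m%:R * f 1%N.
  apply: (le_trans (displacement_le _)).
  by rewrite ler_wpM2r // ler_nat ltnW // ltn_mod.
have := mult (p %/ m)%N (q %/ m)%N.
have := fD (p %/ m * m)%N (p %% m)%N; rewrite -divn_eq.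
have := fD (q %/ m * m)%N (q %% m)%N; rewrite -divn_eq.
have := fB (p %/ m * m + q %/ m * m)%N (p %% m + q %% m)%N.
rewrite addnACA -!divn_eq.
have := (fD (p %% m) (q %% m), small p, small q).
by move=> -[[? ?] ?] ? ? ? ?; lra.
Qed.

End Displacement.

Section Action.
Context {R : realType} {X : metricType R} {G : groupType} (act : G -> X -> X).
Hypothesis act_iso : isometric_action act.
Variables (o : X) (e : R).
Hypotheses (e_ge0 : 0 <= e) (hyp4 : @four_point R X e).
Implicit Types (g h x b : G).

Let act1 p : act 1%g p = p. Proof. by case: act_iso. Qed.
Let actM g h p : act (g * h)%g p = act g (act h p). Proof. by case: act_iso. Qed.
Let actD g p q : mdist (act g p) (act g q) = mdist p q.
Proof. by case: act_iso. Qed.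

Definition disp g := mdist o (act g o).

Lemma disp_ge0 g : 0 <= disp g. Proof. exact: mdist_ge0. Qed.

Lemma dispE g h : mdist (act g o) (act h o) = disp (g^-1 * h)%g.
Proof. by rewrite /disp -(actD g o) -actM mulVKg. Qed.

Lemma dispV g : disp g^-1%g = disp g.
Proof. by rewrite /disp -(actD g) -actM mulgV act1 metric_sym. Qed.

Lemma disp1 : disp 1%g = 0.
Proof. by rewrite /disp act1 mdistxx. Qed.

Lemma dispM g h : disp (g * h)%g <= disp g + disp h.
Proof.
by rewrite -[disp h](actD g) -actM; exact: metric_triangle.
Qed.

Lemma dispX b m n : (m <= n)%N ->
  mdist (act (b ^+ m)%g o) (act (b ^+ n)%g o) = disp (b ^+ (n - m))%g.
Proof. by move=> mn; rewrite dispE -{1}(subnKC mn) expgnDr mulKg. Qed.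

Lemma gprod_act g p q : gprod (act g o) (act g p) (act g q) = gprod o p q.
Proof. by rewrite /gprod !actD. Qed.

Lemma disp_superadditive b (L K : R) : 0 < L ->
  (forall n, L^-1 * n%:R - K <= disp (b ^+ n)%g) ->
  exists c, forall p q,
    disp (b ^+ p)%g + disp (b ^+ q)%g <= disp (b ^+ (p + q))%g + c.
Proof.
move=> L0 lin; apply: (displacement_superadditive e_ge0 _ _ _ _ _ L0 lin).
- by rewrite expg0 disp1.
- by move=> n; exact: disp_ge0.
- by move=> m n; rewrite expgnDr dispM.
- move=> m n; have := dispM (b ^+ (m + n))%g (b ^- n)%g.
  by rewrite expgnDr mulgK dispV.
move=> i j k.
have := hyp4 o (act (b ^+ i)%g o) (act (b ^+ (i + j))%g o)
  (act (b ^+ (i + j + k))%g o).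
rewrite /gprod -/(disp _) -/(disp _) -/(disp _).
rewrite !dispX ?leq_addr //; last by rewrite -addnA leq_addr.
rewrite !addKn -addnA addKn addnA.
by case=> ?; [right|left]; lra.
Qed.

(** Acylindricity enters here.  If x moves the ray (b^n o)_n to one that stays
    with it for a long time, then d(b^j o, x b^j o) <= D for all small j, with D
    independent of j.  So the elements b^-j x b^j move both o and the far point
    b^J o by at most D; two of them are equal, and x commutes with a power of
    b. *)
Lemma gprod_bounded b x c : acylindrical act ->
  (forall M, exists n, M <= disp (b ^+ n)%g) ->
  (forall p q, disp (b ^+ p)%g + disp (b ^+ q)%g <= disp (b ^+ (p + q))%g + c) ->
  (forall m, ~ commute x (b ^+ m.+1)%g) ->
  exists T, forall n, gprod o (act (b ^+ n)%g o) (act (x * b ^+ n)%g o) <= T.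
Proof.
move=> acyl unb sup ncom.
(* D is what the estimate of [moves] below yields. *)
pose D := 3 * disp x + c + 4 * e.
have c0 : 0 <= c by have := sup 0%N 0%N; rewrite disp1; lra.
have x0 := disp_ge0 x; have e0 := e_ge0.
have D0 : 0 <= D by rewrite /D; lra.
have [M [N [M0 few]]] := acyl D D0; have [J HJ] := unb M.
have disp_le n : disp (b ^+ n)%g <= n%:R * disp b.
  rewrite -{2}(expg1 b); apply: (@displacement_le R (fun n => disp (b ^+ n)%g)).
    exact: disp1.
  by move=> p q; rewrite expgnDr dispM.
exists ((N + J)%:R * disp b) => n; rewrite leNgt; apply/negP => far.
have disp_small j : (j <= N + J)%N -> disp (b ^+ j)%g <= (N + J)%:R * disp b.
  move=> jN; apply: (le_trans (disp_le j)).
  by rewrite ler_wpM2r ?disp_ge0 // ler_nat.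
have nNJ : (N + J < n)%N.
  rewrite ltnNge; apply/negP => /disp_small small.
  have := gprod_le o (act (b ^+ n)%g o) (act (x * b ^+ n)%g o).
  by rewrite -/(disp _); lra.
have moves j : (j <= N + J)%N ->
    mdist (act (b ^+ j)%g o) (act (x * b ^+ j)%g o) <= D.
  move=> jNJ; have jn : (j <= n)%N by lia.
  (* b^j o is almost on the way to b^n o, so it is far out in the direction
     of b^n o, hence of x b^n o, hence of x b^j o. *)
  have h1 : disp (b ^+ j)%g - c / 2 <=
      gprod o (act (b ^+ j)%g o) (act (b ^+ n)%g o).
    have := sup j (n - j)%N; rewrite subnKC // /gprod -/(disp _) -/(disp _).
    by rewrite dispX //; lra.
  have h2 : disp (b ^+ j)%g - c / 2 - e <=
      gprod o (act (b ^+ j)%g o) (act (x * b ^+ n)%g o).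
    have := disp_small _ jNJ.
    by case: (hyp4 o (act (b ^+ j)%g o) (act (b ^+ n)%g o)
      (act (x * b ^+ n)%g o)) => ? ?; lra.
  have h3 : disp (b ^+ j)%g - c / 2 - disp x <=
      gprod o (act (x * b ^+ n)%g o) (act (x * b ^+ j)%g o).
    have := gprod_lip (act x o) (act (x * b ^+ n)%g o) (act (x * b ^+ j)%g o)
      o (act (x * b ^+ n)%g o) (act (x * b ^+ j)%g o).
    rewrite !mdistxx !addr0 [mdist (act x o) o]metric_sym -/(disp x).
    have E : gprod (act x o) (act (x * b ^+ n)%g o) (act (x * b ^+ j)%g o) =
        gprod o (act (b ^+ j)%g o) (act (b ^+ n)%g o) :> R.
      by rewrite !(actM x) gprod_act gprodC.
    by rewrite E; lra.
  have h4 : disp (b ^+ j)%g - c / 2 - 2 * e - disp x <=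
      gprod o (act (b ^+ j)%g o) (act (x * b ^+ j)%g o).
    by case: (hyp4 o (act (b ^+ j)%g o) (act (x * b ^+ n)%g o)
      (act (x * b ^+ j)%g o)) => ?; lra.
  move: h4; have := dispM x (b ^+ j)%g.
  by rewrite /gprod -/(disp _) -/(disp _) /D; lra.
pose h j := (b ^- j * (x * b ^+ j))%g.
have hmove j i : mdist (act (b ^+ i)%g o) (act (h j) (act (b ^+ i)%g o)) =
    mdist (act (b ^+ (j + i))%g o) (act (x * b ^+ (j + i))%g o).
  by rewrite -(actD (b ^+ j)%g) -!actM /h !mulgA mulgV mul1g -!mulgA -expgnDr.
have inj : {in `I_N.+1 &, injective h}%classic.
  suff inj' i j : (i < j)%N -> h i <> h j.
    move=> i j _ _ hij; have [ij|ij|//] := ltngtP i j; first by have := inj' _ _ ij.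
    by have := inj' _ _ ij; rewrite hij.
  move=> ij hij; apply: (ncom (j - i.+1)%N); move: hij.
  have {1}-> : j = ((j - i.+1).+1 + i)%N by lia.
  rewrite /h expgnDr invgM -!mulgA => /mulgI; rewrite !mulgA => /mulIg E.
  by rewrite /commute {2}E -!mulgA mulVKg.
have : (`I_N.+1 #<= `I_N)%card.
  apply: card_le_trans (few o (act (b ^+ J)%g o) HJ).
  apply: (@card_le_trans _ _ _ (h @` `I_N.+1)%classic).
    by have := inj_card_eq inj; rewrite card_eq_le => /andP[].
  apply: subset_card_le.
  move=> _ [j /= jN <-]; split.
    have := hmove j 0%N; rewrite expg0 act1 addn0 => ->.
    by apply: moves; lia.
  by rewrite hmove; apply: moves; lia.
by rewrite card_le_II ltnn.
Qed.

End Action.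

(** * Alternating products of long powers *)

Definition spow (G : groupType) (b : G) (eps : bool) n : G :=
  if eps then (b ^- n)%g else (b ^+ n)%g.

Definition connected_powers (G : groupType) (b : G) n (L : seq (bool * G)) : G :=
  foldr (fun s g => spow b s.1 n * (s.2 * g))%g 1%g L.

Definition alternating (T : Type) (L : seq (bool * T)) :=
  sorted (fun s t => t.1 == ~~ s.1) L.

Lemma spowN (G : groupType) (b : G) eps n : spow b (~~ eps) n = (spow b eps n)^-1%g.
Proof. by case: eps => /=; rewrite ?invgK. Qed.

Lemma spowE (G : groupType) (b : G) eps n :
  spow b eps n = ((if eps then b^-1 else b) ^+ n)%g.
Proof. by case: eps => //=; rewrite expVgn. Qed.

Lemma bound_all (R : realType) (T : eqType) (P : T -> R -> Prop) (L : seq T) :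
  (forall s c c', c <= c' -> P s c -> P s c') ->
  (forall s, s \in L -> exists c, P s c) ->
  exists c, forall s, s \in L -> P s c.
Proof.
move=> mono; elim: L => [|s L IHL] HL; first by exists 0.
have [|c Hc] := IHL; first by move=> t tL; apply: HL; rewrite inE tL orbT.
have [c' Hc'] := HL s (mem_head _ _).
exists (Num.max c c') => t; rewrite inE => /predU1P[->|tL].
  by apply: mono Hc'; rewrite le_max lexx orbT.
by apply: mono (Hc t tL); rewrite le_max lexx.
Qed.

Section PingPong.
Context {R : realType} {X : metricType R} {G : groupType} (act : G -> X -> X).
Hypothesis act_iso : isometric_action act.
Variables (o : X) (e : R).
Hypotheses (e_ge0 : 0 <= e) (hyp4 : @four_point R X e).
Local Notation disp := (disp act o).

Let act1 p : act 1%g p = p. Proof. by case: act_iso. Qed.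
Let actM g h p : act (g * h)%g p = act g (act h p). Proof. by case: act_iso. Qed.
Let actD g p q : mdist (act g p) (act g q) = mdist p q.
Proof. by case: act_iso. Qed.

(** A product of long powers of b that turn back without fellow-travelling
    leaves o in the direction of its first power.  By induction on the number of
    powers: seen from the first turning point, the rest of the path goes in the
    direction of s.2 times the next power, and this has a bounded Gromov product
    with the way back to o. *)
Lemma ping_pong (b : G) n c (L : seq (bool * G)) :
  alternating L ->
  {in L, forall s, disp s.2 <= c /\
    gprod o (act (spow b (~~ s.1) n) o) (act (s.2 * spow b (~~ s.1) n)%g o) <= c} ->
  3 * c + 2 * e < disp (b ^+ n)%g ->
  L <> [::] -> connected_powers b n L <> 1%g.
Proof.
move=> altL HL large.
have dspow eps : disp (spow b eps n) = disp (b ^+ n)%g.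
  by case: eps => //=; rewrite (dispV act_iso).
suff head s L' : L = s :: L' ->
    disp (b ^+ n)%g - c - e <=
    gprod o (act (spow b s.1 n) o) (act (connected_powers b n L) o).
  case: L altL HL head => // s L' _ /(_ s (mem_head _ _))[s_small _] head _ L1.
  have := head s L' erefl.
  have := disp_ge0 act o s.2; have := e_ge0.
  rewrite L1 act1 /gprod mdistxx [mdist _ o]metric_sym; lra.
elim: L altL HL s L' => // s L IHL altL HL _ _ [<- _].
have [s_small s_prod] := HL s (mem_head _ _).
set z := connected_powers b n L.
set beta := spow b s.1 n; set beta' := spow b (~~ s.1) n.
have turn : gprod o (act beta' o) (act (s.2 * z)%g o) <= c + e.
  have e0 := e_ge0.
  case: L altL HL IHL @z => [|t L] altL HL IHL z.
    have := gprod_le o (act (s.2 * z)%g o) (act beta' o).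
    by rewrite gprodC /z /= mulg1 -/(disp _); lra.
  move: altL => /andP[/eqP ts altL].
  have := IHL altL _ t L erefl; rewrite ts -/z -/beta'.
  have {}HL : {in t :: L, forall s, disp s.2 <= c /\
    gprod o (act (spow b (~~ s.1) n) o) (act (s.2 * spow b (~~ s.1) n)%g o) <= c}.
    by move=> u uL; apply: HL; rewrite inE uL orbT.
  move=> /(_ HL) IH.
  have far : disp (b ^+ n)%g - 2 * c - e <=
      gprod o (act (s.2 * z)%g o) (act (s.2 * beta')%g o).
    have := gprod_lip (act s.2 o) (act (s.2 * z)%g o) (act (s.2 * beta')%g o)
      o (act (s.2 * z)%g o) (act (s.2 * beta')%g o).
    rewrite !mdistxx !addr0 [mdist (act s.2 o) o]metric_sym -/(disp s.2).
    have E : gprod (act s.2 o) (act (s.2 * z)%g o) (act (s.2 * beta')%g o) =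
        gprod o (act beta' o) (act z o) :> R.
      by rewrite !(actM s.2) (gprod_act act_iso) gprodC.
    by rewrite E; lra.
  by case: (hyp4 o (act beta' o) (act (s.2 * z)%g o)
    (act (s.2 * beta')%g o)) => ?; lra.
have E : gprod o (act beta' o) (act (s.2 * z)%g o) =
    gprod (act beta o) o (act (beta * (s.2 * z))%g o) :> R.
  rewrite -(gprod_act act_iso _ beta) -!actM.
  by rewrite /beta /beta' spowN mulgV act1.
rewrite /= -/z -/beta.
move: turn; rewrite E /gprod -!/(disp _) [mdist (act beta o) o]metric_sym.
by rewrite -!/(disp _) /beta !dspow; lra.
Qed.

End PingPong.

(** If b were loxodromic in an acylindrical action on a hyperbolic space, no
    connector would make a power of b backtrack by an unbounded amount
    ([gprod_bounded] for b and for its inverse), and [ping_pong] would forbid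
    the relations with large n. *)
Theorem not_generalized_loxodromic (R : realType) (G : groupType) (b : G)
    (L : seq (bool * G)) :
  alternating L -> L <> [::] ->
  {in L, forall s m, ~ commute s.2 (b ^+ m.+1)%g} ->
  (forall m, exists2 n, (m <= n)%N & connected_powers b n L = 1%g) ->
  ~ generalized_loxodromic R b.
Proof.
move=> altL L0 ncom rels [X [act [hypX iso acyl [o [lam [K [lam1 K0 lox]]]]]]].
have [e e0 hyp4] := hyperbolic_four_point hypX.
have act1 p : act 1%g p = p by case: iso.
have lam0 : 0 < lam by lra.
have lin n : lam^-1 * n%:R - K <= disp act o (b ^+ n)%g.
  have /= := lox (Posz 0) (Posz n); rewrite act1 sub0r normrN => /andP[].
  by [].
have unb M : exists m, forall n, (m <= n)%N -> M <= disp act o (b ^+ n)%g.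
  have M0 := normr_ge0 M; exists (Num.bound (lam * (`|M| + K))) => n mn.
  apply: le_trans (lin n).
  have : lam * (`|M| + K) < n%:R.
    by apply: lt_le_trans (archi_boundP _) _; rewrite ?ler_nat // mulr_ge0 //; lra.
  rewrite -(ltr_pM2l (x := lam^-1)) ?invr_gt0 // mulKf ?gt_eqF //.
  by have := ler_norm M; lra.
have powV n : disp act o (b^-1 ^+ n)%g = disp act o (b ^+ n)%g.
  by rewrite expVgn (dispV iso).
have [k sup] := disp_superadditive iso e0 hyp4 lam0 lin.
have [c Hc] : exists c, forall s, s \in L -> disp act o s.2 <= c /\
    forall n, gprod o (act (spow b (~~ s.1) n) o)
      (act (s.2 * spow b (~~ s.1) n)%g o) <= c.
  apply: bound_all => [s c c' cc' [h1 h2]|s sL].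
    by split=> [|n]; [exact: le_trans cc'|exact: le_trans (h2 n) cc'].
  set b' := if ~~ s.1 then b^-1%g else b.
  have b'E n : disp act o (b' ^+ n)%g = disp act o (b ^+ n)%g.
    by rewrite /b'; case: ifP.
  have [||m|T HT] := @gprod_bounded _ _ _ _ iso o _ e0 hyp4 b' s.2 k acyl.
  - by move=> M; have [m Hm] := unb M; exists m; rewrite b'E Hm.
  - by move=> p q; rewrite !b'E.
  - move=> com; apply: (ncom _ sL m); move: com; rewrite /b'; case: ifP => // _.
    by move=> /commuteV; rewrite expVgn invgK.
  exists (Num.max (disp act o s.2) T); split=> [|n]; first by rewrite le_max lexx.
  by rewrite !spowE le_max -/b' (HT n) orbT.
have [m Hm] := unb (3 * c + 2 * e + 1).
have [n /Hm large rel] := rels m.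
suff /(_ L0) : L <> [::] -> connected_powers b n L <> 1%g by rewrite rel.
apply: (@ping_pong _ _ _ act iso o e e0 hyp4 b n c L altL); last by lra.
by move=> s sL; have [h1 h2] := Hc s sL.
Qed.

(** * The relators and the small cancellation condition *)

Local Notation letter := (abcd * bool)%type.

Definition is_b (l : letter) := if l.1 is gen_b then true else false.
Definition is_cd (l : letter) :=
  match l.1 with gen_c | gen_d => true | _ => false end.

(** Equality of letters does not reduce, because it goes through an opaque
    bijection with ['I_4]; finite checks on letters are run on these codes. *)
Definition letter_code (l : letter) : nat :=
  (2 * match l.1 with gen_a => 0 | gen_b => 1 | gen_c => 2 | gen_d => 3 end
   + l.2)%N.

Lemma letter_code_inj : injective letter_code.
Proof. by move=> [[] []] [[] []]. Qed.

Fixpoint cd_words k : seq (seq letter) :=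
  if k is k'.+1 then
    [seq (x, false) :: w | x <- [:: gen_c; gen_d], w <- cd_words k']
  else [:: [::]].

(** The powers of b around the four connectors are b^n, b^-n, b^n, b^-n in this
    order.  The two connectors that follow b^n contain a and a^-1, and so do the
    two that follow b^-n: this is why the relators are trivial in the
    lamplighter group. *)
Definition quadruple (w : seq letter) : seq (bool * seq letter) :=
  [:: (false, (gen_a, false) :: rcons w (gen_c, false));
      (true,  (gen_a, false) :: rcons w (gen_d, false));
      (false, (gen_a, true) :: rcons w (gen_c, false));
      (true,  (gen_a, true) :: rcons w (gen_d, false))].

Definition connectors : seq (bool * seq letter) :=
  flatten [seq quadruple w | w <- cd_words 3].

Definition block n (s : bool * seq letter) := nseq n (gen_b, s.1) ++ s.2.

Definition relator_word n : seq letter := flatten [seq block n s | s <- connectors].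

Lemma connectors_all (P : pred (bool * seq letter)) :
  all P connectors -> forall i, (i < 32)%N -> P (nth (false, [::]) connectors i).
Proof. by move=> /all_nthP H i i32; apply: H. Qed.

Lemma size_connector i : (i < 32)%N -> size (nth (false, [::]) connectors i).2 = 5.
Proof.
by move=> i32; apply/eqP; apply: (@connectors_all (fun s => size s.2 == 5)).
Qed.

Lemma connectors_uniq : uniq [seq s.2 | s <- connectors].
Proof.
by apply: (@map_uniq _ _ (map letter_code)); vm_compute.
Qed.

Lemma nth_flatten_uniform (T : Type) (x0 : T) N (ss : seq (seq T)) i j :
  all (fun s => size s == N) ss -> (i < size ss)%N -> (j < N)%N ->
  nth x0 (flatten ss) (i * N + j) = nth x0 (nth [::] ss i) j.
Proof.
elim: ss i => [|s ss IHss] [|i] //= /andP[/eqP sN ssN] iss jN; rewrite nth_cat sN.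
  by rewrite jN.
by rewrite mulSn -addnA ltnNge leq_addr /= addKn IHss.
Qed.

Lemma size_block n i : (i < 32)%N ->
  size (block n (nth (false, [::]) connectors i)) = (n + 5)%N.
Proof. by move=> i32; rewrite size_cat size_nseq size_connector. Qed.

Lemma blocks_uniform n :
  all (fun s => size s == (n + 5)%N) [seq block n s | s <- connectors].
Proof.
apply/(all_nthP [::]) => i; rewrite size_map => i32.
by rewrite (nth_map (false, [::])) // size_block.
Qed.

Lemma size_relator_word n : size (relator_word n) = (32 * (n + 5))%N.
Proof.
rewrite size_flatten /shape -map_comp.
have /all_pred1P -> : all (pred1 (n + 5)%N) [seq size (block n s) | s <- connectors].
  by have := blocks_uniform n; rewrite !all_map.
by rewrite size_map sumn_nseq mulnC.
Qed.

Lemma modn_block a N : (0 < N)%N ->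
  (a %% (32 * N) = ((a %/ N) %% 32) * N + a %% N)%N.
Proof.
move=> N0; rewrite {1}(divn_eq a N) {1}(divn_eq (a %/ N) 32) mulnDl -mulnA -addnA.
rewrite modnMDl modn_small //.
have := ltn_pmod (a %/ N) (isT : 0 < 32)%N; have := ltn_pmod a N0.
move: (a %% N)%N (_ %% 32)%N => u v; nia.
Qed.

Definition cyc_letter n t : letter :=
  nth (gen_b, false) (relator_word n) (t %% (32 * (n + 5))).

(** All blocks have length n + 5, so a position splits into the index of its
    block and its place in the block by a Euclidean division. *)
Lemma cyc_letterE n t : cyc_letter n t =
  nth (gen_b, false)
    (block n (nth (false, [::]) connectors ((t %/ (n + 5)) %% 32))) (t %% (n + 5)).
Proof.
have i32 := ltn_pmod (t %/ (n + 5)) (isT : 0 < 32)%N.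
rewrite /cyc_letter modn_block ?addn_gt0 ?orbT //.
rewrite nth_flatten_uniform ?blocks_uniform ?ltn_pmod ?addn_gt0 ?orbT //.
by rewrite (nth_map (false, [::])).
Qed.

Lemma cyc_letter_is_b n t : is_b (cyc_letter n t) = (t %% (n + 5) < n)%N.
Proof.
have i32 := ltn_pmod (t %/ (n + 5)) (isT : 0 < 32)%N.
have := ltn_pmod t (isT : 0 < 5 + n)%N; rewrite addnC => jN.
rewrite cyc_letterE nth_cat size_nseq; case: ltnP => jn.
  by rewrite nth_nseq jn.
have : all (fun s => all (predC is_b) s.2) connectors by [].
move=> /connectors_all /(_ _ i32) /(all_nthP (gen_b, false)) H.
by apply/negbTE/H; rewrite size_connector // ltn_subLR.
Qed.

Lemma nth_rot (T : Type) (x0 : T) p s t : (p <= size s)%N -> (t < size s)%N ->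
  nth x0 (rot p s) t = nth x0 s ((p + t) %% size s).
Proof.
move=> ps ts; rewrite /rot nth_cat size_drop nth_drop; case: ltnP => pt.
  by rewrite modn_small //; lia.
rewrite nth_take; last by lia.
congr (nth _ _ _); rewrite -[in RHS](subnK (_ : size s <= p + t)%N); last by lia.
by rewrite modnDr modn_small; lia.
Qed.

Lemma nth_rot_relator n p t :
  (p < 32 * (n + 5))%N -> (t < 32 * (n + 5))%N ->
  nth (gen_b, false) (rot p (relator_word n)) t = cyc_letter n (p + t).
Proof.
by move=> pN tN; rewrite nth_rot size_relator_word // ltnW.
Qed.

Lemma block_start p n : exists t,
  (n + 5 <= t < 2 * (n + 5))%N /\ ((p + t) %% (n + 5) = n)%N.
Proof.
have N0 : (0 < n + 5)%N by lia.
have := ltn_pmod p N0 => pN.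
exists (n + 5 + (n + (n + 5 - p %% (n + 5))) %% (n + 5))%N; split.
  by have := ltn_pmod (n + (n + 5 - p %% (n + 5))) N0; lia.
rewrite addnCA modnDl modnDmr addnCA -modnDml.
rewrite -modnDmr -[((p + _) %% _)%N]modnDml subnKC ?modnn ?addn0; last by lia.
by rewrite modn_mod modn_small; lia.
Qed.

(** The letters of the connectors are not b, so the positions of the letters b
    show the block length and the phase: between two consecutive connectors
    there are exactly n letters b^+-1. *)
Lemma block_length_unique n m a b t0 : (0 < n)%N -> (0 < m)%N ->
  (forall t, (t < 3 * (n + 5))%N ->
    (((a + t) %% (n + 5) < n) = ((b + t) %% (m + 5) < m))%N) ->
  (n + 5 <= t0 < 2 * (n + 5))%N -> ((a + t0) %% (n + 5) = n)%N ->
  n = m /\ ((b + t0) %% (m + 5) = m)%N.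
Proof.
move=> n0 m0 same /andP[t1 t2] an.
have bm : ((b + t0) %% (m + 5) = m)%N.
  have pred_mod c d : ((c + t0) %% d =
      if d %| c + t0 then 0 else ((c + t0.-1) %% d).+1)%N.
    by rewrite -{1 2}(prednK (_ : 0 < t0)%N) ?addnS ?modnS; lia.
  have same0 := same t0 ltac:(lia); have same1 := same t0.-1 ltac:(lia).
  move: an same0 same1; rewrite (pred_mod a).
  case: ifP => _; first by lia.
  by rewrite (pred_mod b); case: ifP => _; lia.
have after d c j : ((c + t0) %% (d + 5) = d)%N -> (j < d + 5)%N ->
    ((c + (t0 + 5 + j)) %% (d + 5) = j)%N.
  move=> cd jd; rewrite !addnA -addnA (divn_eq (c + t0) (d + 5)) cd.
  have -> : ((c + t0) %/ (d + 5) * (d + 5) + d + (5 + j) =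
    ((c + t0) %/ (d + 5)).+1 * (d + 5) + j)%N by lia.
  by rewrite modnMDl modn_small.
split=> //; have [nm|mn|//] := ltngtP n m.
  have := same (t0 + 5 + n)%N; rewrite !after //; try lia.
have := same (t0 + 5 + m)%N; rewrite !after //; lia.
Qed.

(** A subword of length at least 3(n + 5) contains a whole connector followed by
    a whole power of b and the beginning of the next connector.  The power of b
    determines n, and the connectors are pairwise distinct, so that the position
    in the relator is determined too. *)
Lemma common_prefix_unique n m p q (u : seq letter) : (0 < n)%N -> (0 < m)%N ->
  prefix u (rot p (relator_word n)) -> prefix u (rot q (relator_word m)) ->
  (32 * (n + 5) <= 6 * size u)%N ->
  rot p (relator_word n) = rot q (relator_word m).
Proof.
move=> n0 m0.
wlog pN : p / (p < 32 * (n + 5))%N => [H|].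
  have [|pn] := ltnP p (32 * (n + 5)); first exact: H.
  have -> : rot p (relator_word n) = rot 0 (relator_word n).
    by rewrite rot0 rot_oversize ?size_relator_word.
  by apply: H; lia.
wlog qN : q / (q < 32 * (m + 5))%N => [H|].
  have [|qm] := ltnP q (32 * (m + 5)); first exact: H.
  have -> : rot q (relator_word m) = rot 0 (relator_word m).
    by rewrite rot0 rot_oversize ?size_relator_word.
  by apply: H; lia.
move=> uX uY large.
have uXs : (size u <= 32 * (n + 5))%N.
  by have := size_prefix uX; rewrite size_rot size_relator_word.
have uYs : (size u <= 32 * (m + 5))%N.
  by have := size_prefix uY; rewrite size_rot size_relator_word.
have same t : (t < 3 * (n + 5))%N -> cyc_letter n (p + t) = cyc_letter m (q + t).
  move=> tN; rewrite -!nth_rot_relator //; try lia.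
  have tu : (t < size u)%N by lia.
  move: uX uY => /prefixP[v ->] /prefixP[w ->].
  by rewrite !nth_cat tu.
have [t0 [t0N pt0]] := block_start p n.
have same_b t : (t < 3 * (n + 5))%N ->
    (((p + t) %% (n + 5) < n) = ((q + t) %% (m + 5) < m))%N.
  by move=> tN; rewrite -!cyc_letter_is_b same.
have [E qt0] := block_length_unique n0 m0 same_b t0N pt0.
move: E qN uY uYs same same_b qt0 => <- {m m0} qN uY uYs same same_b qt0.
set N := (n + 5)%N in pN qN large uXs uYs same same_b pt0 qt0 t0N *.
have N0 : (0 < N)%N by rewrite /N; lia.
pose ip := ((p + t0) %/ N %% 32)%N; pose iq := ((q + t0) %/ N %% 32)%N.
have ip32 : (ip < 32)%N by rewrite ltn_pmod.
have iq32 : (iq < 32)%N by rewrite ltn_pmod.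
have token c j : (j < 5)%N -> ((c + t0) %% N = n)%N ->
    cyc_letter n (c + (t0 + j)) = nth (gen_b, false)
      (nth (false, [::]) connectors ((c + t0) %/ N %% 32)).2 j.
  move=> j5 cn; rewrite cyc_letterE -/N.
  have -> : (c + (t0 + j) = (c + t0) %/ N * N + (n + j))%N.
    by rewrite addnA {1}(divn_eq (c + t0) N) cn addnA.
  have nj : (n + j < N)%N by rewrite /N; lia.
  rewrite modnMDl divnMDl // (divn_small nj) addn0 (modn_small nj).
  by rewrite nth_cat size_nseq ltnNge leq_addr /= addKn.
have ipq : ip = iq.
  apply/eqP; rewrite -(nth_uniq [::] _ _ connectors_uniq) ?size_map //.
  rewrite !(nth_map (false, [::])) //; apply/eqP.
  apply: (@eq_from_nth _ (gen_b, false)); rewrite !size_connector // => j j5.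
  by rewrite -!token // same //; move: t0N; rewrite /N; lia.
have : ((p + t0) %% (32 * N) = (q + t0) %% (32 * N))%N.
  by rewrite !modn_block // -/ip -/iq ipq pt0 qt0.
by move/eqP; rewrite eqn_modDr !modn_small // => /eqP ->.
Qed.

Lemma no_cancelE x y :
  no_cancel x y = (letter_code y != letter_code (linv x)).
Proof. by rewrite (inj_eq letter_code_inj). Qed.

Lemma no_cancel_b x y : is_b x != is_b y -> no_cancel x y.
Proof. by rewrite no_cancelE; case: x y => [[] []] [[] []]. Qed.

Lemma path_powers n x (L : seq (bool * seq letter)) : ~~ is_b x ->
  all (fun s => [&& s.2 != [::], all (predC is_b) s.2 & sorted (@no_cancel _) s.2]) L ->
  let w := flatten [seq block n.+1 s | s <- L] in
  path (@no_cancel _) x w && ~~ is_b (last x w).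
Proof.
elim: L x => [|[eps [|h t]] L IHL] x xb //=.
move=> /andP[/andP[/andP[hb tb] ht] /(IHL (last h t))].
rewrite -!catA !cat_path /= !last_cat /=.
have path_b k : path (@no_cancel _) (gen_b, eps) (nseq k (gen_b, eps)).
  by elim: k => //= k ->; rewrite no_cancelE; case: (eps).
have last_b k : last (gen_b, eps) (nseq k (gen_b, eps)) = (gen_b, eps).
  by elim: k.
rewrite last_b path_b /= last_cat ht andbT => IH.
have lastb : ~~ is_b (last h t).
  have : last h t \in h :: t by exact: mem_last.
  by rewrite inE => /predU1P[->//|]; exact: (allP tb).
have /andP[-> ->] := IH lastb.
by rewrite !no_cancel_b //= ?(negbTE xb) ?(negbTE hb).
Qed.

Lemma connectors_good :
  all (fun s => [&& s.2 != [::], all (predC is_b) s.2 & sorted (@no_cancel _) s.2])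
    connectors.
Proof.
apply: (@sub_all _ (fun s => [&& size s.2 != 0, all (predC is_b) s.2 &
  sorted (fun x y => letter_code y != letter_code (linv x)) s.2])) => // s.
rewrite size_eq0 => /and3P[-> -> h] /=.
by apply: sub_sorted h => x y; rewrite no_cancelE.
Qed.

Lemma cyc_reduced_relator n : cyc_reduced (relator_word n.+1).
Proof.
rewrite /cyc_reduced (cycle_path (gen_a, false)).
have xa : ~~ is_b (gen_a, false) by [].
have /= /andP[_ lastW] := path_powers n xa connectors_good.
by have /= /andP[] := path_powers n lastW connectors_good.
Qed.

Lemma reduced_relator n : reduced (relator_word n.+1).
Proof.
have := cyc_reduced_relator n.
by rewrite /cyc_reduced (cycle_path (gen_a, false)) => /path_sorted.
Qed.

(** The exponent n + 1 is positive, so that the connectors are the maximal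
    subwords without b and consecutive ones do not merge. *)
Definition relator n : freegrp abcd := FreeGrp (reduced_relator n).

Lemma size_relator n : size (relator n) = (32 * (n + 6))%N.
Proof. by rewrite [LHS]size_relator_word addSnnS. Qed.

Lemma winv_cat (S : choiceType) (u v : seq (S * bool)) :
  winv (u ++ v) = winv v ++ winv u.
Proof. by rewrite /winv map_cat rev_cat. Qed.

Lemma size_winv (S : choiceType) (u : seq (S * bool)) : size (winv u) = size u.
Proof. by rewrite size_rev size_map. Qed.

Lemma winv_rot (S : choiceType) k (u : seq (S * bool)) :
  winv (rotr k u) = rot k (winv u).
Proof. by rewrite /winv map_rotr rev_rotr. Qed.

Definition is_pos_cd (l : letter) := is_cd l && ~~ l.2.
Definition is_neg_cd (l : letter) := is_cd l && l.2.

(** A long subword of a relator contains the end of a connector, which is c or d;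
    the inverses of the relators contain only c^-1 and d^-1.  Hence a relator and
    the inverse of a relator have no long common subword. *)
Lemma has_pos_cd n p u : prefix u (rot p (relator_word n.+1)) ->
  (32 * (n.+1 + 5) <= 6 * size u)%N -> has is_pos_cd u.
Proof.
wlog pN : p / (p < 32 * (n.+1 + 5))%N => [H|].
  have [|pn] := ltnP p (32 * (n.+1 + 5)); first exact: H.
  have -> : rot p (relator_word n.+1) = rot 0 (relator_word n.+1).
    by rewrite rot0 rot_oversize ?size_relator_word.
  by apply: H; lia.
move=> uX large; have [t0 [t0N pt0]] := block_start p n.+1.
have tu : (t0 + 4 < size u)%N by lia.
have uXs : (size u <= 32 * (n.+1 + 5))%N.
  by have := size_prefix uX; rewrite size_rot size_relator_word.
apply/(has_nthP (gen_b, false)); exists (t0 + 4)%N => //.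
have -> : nth (gen_b, false) u (t0 + 4) = cyc_letter n.+1 (p + (t0 + 4)).
  rewrite -nth_rot_relator //; last by lia.
  by move: uX => /prefixP[v ->]; rewrite nth_cat tu.
rewrite cyc_letterE addnA (divn_eq (p + t0) (n.+1 + 5)) pt0 -addnA.
set q := ((p + t0) %/ _)%N; have n4 : (n.+1 + 4 < n.+1 + 5)%N by rewrite ltn_add2l.
rewrite modnMDl divnMDl // (divn_small n4) addn0 (modn_small n4).
rewrite nth_cat size_nseq ltnNge leq_addr /= addKn.
apply: (@connectors_all (fun s => is_pos_cd (nth (gen_b, false) s.2 4))) => //.
by rewrite ltn_mod.
Qed.

Lemma no_neg_cd n : ~~ has is_neg_cd (relator_word n).
Proof.
apply/hasPn => l /flattenP[_ /mapP[s sL ->]].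
rewrite mem_cat => /orP[/nseqP[-> _]//|ls].
have : all (fun s => all (predC is_neg_cd) s.2) connectors by [].
by move=> /allP/(_ s sL)/allP/(_ l ls).
Qed.

Lemma has_rot (T : Type) (a : pred T) k s : has a (rot k s) = has a s.
Proof. by rewrite has_cat orbC -has_cat cat_take_drop. Qed.

Lemma has_winv u : has is_neg_cd (winv u) = has is_pos_cd u.
Proof.
rewrite has_rev has_map; apply: eq_has => l.
by rewrite /= /is_neg_cd /is_pos_cd.
Qed.

(** Common prefixes of inverses of relators come from common suffixes, which a
    rotation brings to the front. *)
Lemma common_suffix_unique n m p q u :
  suffix u (rot p (relator_word n.+1)) -> suffix u (rot q (relator_word m.+1)) ->
  (32 * (n.+1 + 5) <= 6 * size u)%N ->
  rot p (relator_word n.+1) = rot q (relator_word m.+1).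
Proof.
move=> /suffixP[v Ev] /suffixP[w Ew] large.
have Rv : rot (size v) (rot p (relator_word n.+1)) = u ++ v by rewrite Ev rot_size_cat.
have Rw : rot (size w) (rot q (relator_word m.+1)) = u ++ w by rewrite Ew rot_size_cat.
have E : u ++ v = u ++ w.
  move: (prefix_prefix u v) (prefix_prefix u w).
  rewrite -Rv -Rw !rot_rot_add => h1 h2; exact: common_prefix_unique h1 h2 large.
by rewrite Ev Ew; move/eqP: E; rewrite eqseq_cat // eqxx => /eqP ->.
Qed.

Section SmallCancellation.
Variable f : nat -> nat.
Let r i := relator (f i).

Lemma symmetrizedP x : symmetrized r x -> exists n p,
  fword x = rot p (relator_word n.+1) \/ fword x = winv (rot p (relator_word n.+1)).
Proof.
move=> [i [[p E]|[p E]]]; exists (f i); first by exists p; left.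
exists (size (relator_word (f i).+1) - p)%N; right; rewrite E.
by rewrite -[rot (_ - _) _]/(rotr p _) winv_rot.
Qed.

Lemma prefix_winv (S : choiceType) (u v : seq (S * bool)) :
  prefix u (winv v) -> suffix (winv u) v.
Proof.
move=> /prefixP[w E]; apply/suffixP; exists (winv w).
by rewrite -winv_cat -E winvK.
Qed.

(** A relator consists of 32 blocks of the same length, a subword of three blocks
    determines it, and 32/6 > 3.  Two inverses of relators, and a relator and an
    inverse, are treated by [common_suffix_unique] and [has_pos_cd]. *)
Lemma relators_small_cancellation x y (u : seq letter) :
  symmetrized r x -> symmetrized r y ->
  x <> y -> prefix u x -> prefix u y -> (6 * size u < size x)%N.
Proof.
move=> /symmetrizedP[n [p Ex]] /symmetrizedP[m [q Ey]] xy ux uy.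
rewrite ltnNge; apply/negP => large; apply: xy; apply/val_inj => /=.
have neg k l w : prefix w (rot l (relator_word k)) -> ~~ has is_neg_cd w.
  move=> /prefixP[v E]; have := no_neg_cd k.
  by rewrite -(has_rot _ l) E has_cat negb_or => /andP[].
have neg_suffix k l w : suffix w (rot l (relator_word k)) -> ~~ has is_neg_cd w.
  move=> /suffixP[v E]; have := no_neg_cd k.
  by rewrite -(has_rot _ l) E has_cat negb_or => /andP[].
have suffix_pos k l w : suffix w (rot l (relator_word k.+1)) ->
    (32 * (k.+1 + 5) <= 6 * size w)%N -> has is_pos_cd w.
  move=> /suffixP[v E] big; apply: (@has_pos_cd k (rot_add (relator_word k.+1) l (size v))) big.
  by rewrite -rot_rot_add E rot_size_cat prefix_prefix.
have Sx : size x = (32 * (n.+1 + 5))%N.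
  by case: Ex => ->; rewrite ?size_winv size_rot size_relator_word.
rewrite Sx in large.
case: Ex Ey ux uy => -> [] -> ux uy.
- exact: common_prefix_unique ux uy large.
- have := neg_suffix _ _ _ (prefix_winv uy).
  by rewrite has_winv (has_pos_cd ux large).
- have := neg _ _ _ uy; rewrite -[u]winvK has_winv (suffix_pos _ _ _ (prefix_winv ux)) //.
  by rewrite size_winv.
- congr winv; apply: (common_suffix_unique (prefix_winv ux) (prefix_winv uy)).
  by rewrite size_winv.
Qed.

End SmallCancellation.

(** * Actions of presented groups *)

Section WordAction.
Context {S : choiceType} {T : Type} (la : S * bool -> T -> T).
Hypothesis laK : forall l t, la l (la (linv l) t) = t.

Definition run (w : seq (S * bool)) (t : T) := foldr la t w.

Lemma run_lmul l w t : run (lmul l w) t = la l (run w t).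
Proof. by case: w => //= k w; case: eqVneq => [->|] //=; rewrite laK. Qed.

Lemma run_wmul u v t : run (wmul u v) t = run u (run v t).
Proof. by elim: u => //= l u IHu; rewrite run_lmul IHu. Qed.

Lemma run_cat u v t : run (u ++ v) t = run u (run v t).
Proof. exact: foldr_cat. Qed.

Lemma run_mul (u v : freegrp S) t : run (u * v)%g t = run u (run v t).
Proof. exact: run_wmul. Qed.

Lemma run_inv (u : freegrp S) t : run u (run u^-1%g t) = t.
Proof. by rewrite -run_mul mulgV. Qed.

Variable r : nat -> freegrp S.
Hypothesis r_trivial : forall i t, run (r i) t = t.

(** The elements of the free group that act trivially form a normal subgroup. *)
Lemma run_normal_closure u : normal_closure (range r) u -> forall t, run u t = t.
Proof.
move=> /(_ [set v | forall t, run v t = t]%classic); apply; last first.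
  by move=> _ [i _ <-].
have V (v : freegrp S) t : (forall t, run v t = t) -> run v^-1%g t = t.
  by move=> vt; rewrite -[LHS]vt run_inv.
split=> // [{}u v ut vt t|v g vt t].
  by rewrite run_mul V ?ut.
by rewrite run_mul run_mul vt -[in X in run _ X](invgK g) run_inv.
Qed.

Lemma run_qpi u v : qpi (range r) u = qpi (range r) v -> run u =1 run v.
Proof.
move=> /qpiP/run_normal_closure uv t.
by rewrite -[run v t]uv -run_mul mulgVK.
Qed.

Definition qrun (g : presented r) := run (qrepr g).

Lemma qrunE u t : qrun (qpi (range r) u) t = run u t.
Proof. by apply: run_qpi; rewrite qreprK. Qed.

Lemma qrunM g h t : qrun (g * h)%g t = qrun g (qrun h t).
Proof.
rewrite -{1}(qreprK g) -{1}(qreprK h).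
have -> : (qpi _ (qrepr g) * qpi _ (qrepr h))%g =
  qpi (range r) (qrepr g * qrepr h)%g :> presented r by rewrite qpiM.
by rewrite qrunE run_mul.
Qed.

End WordAction.

Section Presented.
Context {S : choiceType} (r : nat -> freegrp S).
Let G : groupType := presented r.

Definition letter_val (l : S * bool) : G :=
  if l.2 then (pgen r l.1)^-1%g else pgen r l.1.

(** The image of a word in the presented group, as the value at 1 of the action
    of the letters by left multiplication. *)
Definition word_val (w : seq (S * bool)) : G :=
  run (fun l g => letter_val l * g)%g w 1%g.

Lemma word_valM u v : word_val (u ++ v) = (word_val u * word_val v)%g.
Proof.
rewrite /word_val run_cat; elim: u => /= [|l u IHu]; first by rewrite mul1g.
by rewrite IHu mulgA.
Qed.

Lemma word_val_nseq n s eps : word_val (nseq n (s, eps)) = spow (pgen r s) eps n.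
Proof.
rewrite spowE; elim: n => [|n IHn] //=.
by rewrite -/(word_val _) IHn expgS /letter_val; case: (eps).
Qed.

Lemma qpi_word (u : freegrp S) : qpi (range r) u = word_val u.
Proof.
case: u => w rw; rewrite /=; elim: w rw => [|[s e] w IHw] rw.
  by have -> : FreeGrp rw = 1%g by exact/val_inj.
have rw' := reduced_tail rw; rewrite /= -/(word_val w) -(IHw rw').
pose l : freegrp S := @FreeGrp S [:: (s, e)] isT.
have -> : FreeGrp rw = (l * FreeGrp rw')%g.
  by apply/val_inj; rewrite /= lmul_red.
rewrite [LHS]qpiM; congr (_ * _)%g; rewrite /letter_val /l.
case: (e) => /=; last by congr (qpi _ _); exact/val_inj.
by rewrite -[RHS](qpiV (range r)); congr (qpi _ _); exact/val_inj.
Qed.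

Lemma relator_val i : word_val (r i) = 1%g.
Proof.
rewrite -qpi_word; apply/qpiP.
have -> : (r i / 1)%g = r i by rewrite divg1.
by move=> N _; apply; exists i.
Qed.

End Presented.

(** * The lamplighter quotient *)

Definition sgb (e : bool) : int := if e then -1 else 1.

Definition at0 (p : int) : int := if p == 0 then 1 else 0.

(** An action of the lamplighter group Z wr Z on Z x Z: b shifts the first
    coordinate, and a adds 1 to the second one on the column 0 only.  The amounts
    that an element adds on the various columns are the states of its lamps. *)
Definition lamp (l : letter) (t : int * int) : int * int :=
  match l.1 with
  | gen_a => (t.1, t.2 + sgb l.2 * at0 t.1)
  | gen_b => (t.1 + sgb l.2, t.2)
  | _ => t
  end.

Lemma lampK l t : lamp l (lamp (linv l) t) = t.
Proof.
case: l t => [[] e] [p q] //=; rewrite /lamp /=; congr (_, _).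
  by case: e => /=; rewrite ?mul1r ?mulN1r ?addrNK ?addrK.
by case: e => /=; rewrite ?addrNK ?addrK.
Qed.

Lemma run_lamp_fst w t : (run lamp w t).1 = t.1 + (run lamp w (0, 0)).1.
Proof.
elim: w t => [|[[] e] w IHw] t /=; rewrite ?addr0 // IHw //=.
by rewrite addrA.
Qed.

Lemma run_lamp_b n e t : run lamp (nseq n (gen_b, e)) t = (t.1 + sgb e * n%:Z, t.2).
Proof.
elim: n => [|n IHn] /=; first by rewrite mulr0 addr0; case: t.
by rewrite IHn /lamp /= -addn1 PoszD mulrDr mulr1 addrA.
Qed.

Lemma run_lamp_cd w t : all is_cd w -> run lamp w t = t.
Proof. by elim: w => //= [[[] e]] w IHw //= /IHw ->. Qed.

Lemma run_lamp_block n e e' w x t : all is_cd w -> is_cd x ->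
  run lamp (nseq n (gen_b, e) ++ (gen_a, e') :: rcons w x) t =
  (t.1 + sgb e * n%:Z, t.2 + sgb e' * at0 t.1).
Proof.
move=> wcd xcd; rewrite run_cat run_lamp_b /= run_lamp_cd //.
by rewrite all_rcons xcd.
Qed.

Lemma cd_words_cd k : all (all is_cd) (cd_words k).
Proof.
elim: k => //= k /allP IHk; rewrite cats0 all_cat !all_map.
by apply/andP; split; apply/allP => w /IHk.
Qed.

Lemma lamp_quadruple n w t : all is_cd w ->
  run lamp (flatten [seq block n s | s <- quadruple w]) t = t.
Proof.
move=> wcd; case: t => p q.
rewrite /= cats0 !(run_cat _ (block _ _)) /block /= !run_lamp_block //=.
by rewrite mulN1r mul1r !addrNK; congr (_, _); ring.
Qed.

Lemma lamp_relator n t : run lamp (relator_word n) t = t.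
Proof.
rewrite /relator_word /connectors.
elim: (cd_words 3) (cd_words_cd 3) t => // w ws IHws /andP[wcd wscd] t.
by rewrite map_cat flatten_cat run_cat lamp_quadruple // IHws.
Qed.

Section LampQuotient.
Variable f : nat -> nat.
Let r i := relator (f i).

Definition lamp_quot (g : presented r) := qrun lamp g.

Lemma lamp_quotM (g h : presented r) t :
  lamp_quot (g * h)%g t = lamp_quot g (lamp_quot h t).
Proof. by apply: (qrunM lampK) => i u; exact: lamp_relator. Qed.

Lemma lamp_quot_qpi u t : lamp_quot (qpi (range r) u) t = run lamp u t.
Proof. by apply: (qrunE lampK) => i v; exact: lamp_relator. Qed.

Lemma lamp_quot_word w t : lamp_quot (word_val r w) t = run lamp w t.
Proof.
elim: w t => [|[s e] w IHw] t; first exact: lamp_quot_qpi.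
rewrite -cat1s word_valM lamp_quotM IHw run_cat.
pose l : freegrp abcd := @FreeGrp abcd [:: (s, e)] isT.
by rewrite -[[:: _]]/(fword l) -qpi_word lamp_quot_qpi.
Qed.

(** A connector changes the second coordinate of (0, 0), but not after a power of
    b has moved that point out of the column 0. *)
Lemma connector_not_commute s m : s \in connectors ->
  ~ commute (word_val r s.2) (pgen r gen_b ^+ m.+1)%g.
Proof.
move=> sL com; have : all (fun s => if s.2 is (gen_a, _) :: w then all is_cd w else false)
  connectors by [].
move=> /allP/(_ s sL); case: s sL com => eps [|[[] e] w] //= sL com wcd.
have : lamp_quot (word_val r (((gen_a, e) :: w) ++ nseq m.+1 (gen_b, false))) (0, 0) =
    lamp_quot (word_val r (nseq m.+1 (gen_b, false) ++ (gen_a, e) :: w)) (0, 0).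
  by congr lamp_quot; rewrite !word_valM word_val_nseq; exact: com.
rewrite !lamp_quot_word !run_cat !run_lamp_b /= !run_lamp_cd //.
by rewrite /lamp /= => -[]; case: (e).
Qed.

Lemma relator_powers n :
  connected_powers (pgen r gen_b) n [seq (s.1, word_val r s.2) | s <- connectors] =
  word_val r (relator_word n).
Proof.
rewrite /relator_word; elim: connectors => //= s L IHL.
by rewrite IHL /block !word_valM word_val_nseq mulgA.
Qed.

Lemma relators_not_generalized_loxodromic (R : realType) :
  (forall m, exists i, (m <= f i)%N) ->
  ~ generalized_loxodromic R (pgen r gen_b).
Proof.
move=> unb.
apply: (@not_generalized_loxodromic R _ _
  [seq (s.1, word_val r s.2) | s <- connectors]) => //.
- move=> _ /mapP[s sL ->] m; exact: connector_not_commute.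
move=> m; have [i mi] := unb m; exists (f i).+1; first by rewrite ltnW.
by rewrite relator_powers; exact: (relator_val r i).
Qed.

(** The exponent sum of b. *)
Definition b_exp (g : presented r) : int := (lamp_quot g (0, 0)).1.

Lemma b_expM g h : b_exp (g * h)%g = b_exp g + b_exp h.
Proof.
rewrite /b_exp lamp_quotM [in RHS]addrC.
by rewrite /lamp_quot /qrun run_lamp_fst.
Qed.

Lemma b_exp_gen s : b_exp (pgen r s) = if s is gen_b then 1 else 0.
Proof. by rewrite /b_exp [lamp_quot _ _]lamp_quot_qpi; case: s. Qed.

Lemma b_exp1 : b_exp 1%g = 0.
Proof. by rewrite /b_exp [lamp_quot _ _]lamp_quot_qpi. Qed.

Local Notation b := (pgen r gen_b).

Lemma expgzS (G : groupType) (x : G) m : expgz x (m + 1) = (expgz x m * x)%g.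
Proof.
case: m => [k|[|k]]; first by rewrite /= addn1 expgSr.
  by rewrite /= mulVg.
have -> : Negz k.+1 + 1 = Negz k by lia.
by rewrite /= (expgS x k.+1) invgM mulgVK.
Qed.

Lemma b_exp_expgz m : b_exp (expgz b m) = m.
Proof.
have pos k : b_exp (b ^+ k)%g = k.
  elim: k => [|k IHk]; first exact: b_exp1.
  by rewrite expgS b_expM IHk b_exp_gen; lia.
case: m => [k|k] /=; first exact: pos.
have := b_expM (b ^- k.+1)%g (b ^+ k.+1)%g.
by rewrite mulVg b_exp1 pos; lia.
Qed.

Lemma b_exp_walk (g h : presented r) n :
  cay_walk g h n -> `|b_exp g - b_exp h| <= n%:Z.
Proof.
move=> /asboolP[p [pp <- <-]]; elim: p g pp => [|x p IHp] g /=; first by rewrite subrr.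
move=> /andP[/asboolP[s gx] /IHp xp].
have : `|b_exp g - b_exp x| <= 1.
  by case: gx => ->; rewrite b_expM b_exp_gen; case: s; lia.
move=> gx1; apply: le_trans (ler_distD (b_exp x) _ _) _.
by rewrite -add1n PoszD lerD.
Qed.

Lemma cay_walk0 (g : presented r) : cay_walk g g 0.
Proof. by apply/asboolP; exists [::]. Qed.

Lemma cay_walk_cons (g x h : presented r) n :
  cay_adj g x -> cay_walk x h n -> cay_walk g h n.+1.
Proof.
move=> gx /asboolP[p [pp pl ps]]; apply/asboolP; exists (x :: p).
by rewrite /= gx pp pl ps.
Qed.

Lemma cay_walk_powers m k :
  cay_walk (expgz b m) (expgz b (m + k%:Z)) k /\
  cay_walk (expgz b (m + k%:Z)) (expgz b m) k.
Proof.
elim: k m => [|k IHk] m.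
  by rewrite addr0; split; exact: cay_walk0.
have adj1 : cay_adj (expgz b m) (expgz b (m + 1)).
  by apply/asboolP; exists gen_b; left; exact: expgzS.
have adj2 : cay_adj (expgz b (m + k.+1%:Z)) (expgz b (m + k%:Z)).
  apply/asboolP; exists gen_b; right; rewrite -expgzS.
  by rewrite -addrA -PoszD addn1.
split; last exact: cay_walk_cons adj2 (IHk m).2.
apply: cay_walk_cons adj1 _; have [+ _] := IHk (m + 1).
by have -> : m + 1 + k%:Z = m + k.+1%:Z by lia.
Qed.

(** The exponent sum changes by at most 1 along an edge. *)
Lemma cay_dist_powers m n :
  (cay_dist (expgz b m) (expgz b n))%:Z = `|m - n|.
Proof.
rewrite /cay_dist; case: ex_minnP => d walk min.
have lower := b_exp_walk walk; rewrite !b_exp_expgz in lower.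
apply/eqP; rewrite eq_le lower andbT -[leRHS]abszE lez_nat; apply: min.
have [mn|nm] := leP m n.
  have := (cay_walk_powers m `|m - n|%N).1.
  by have -> : m + `|m - n|%N = n by lia.
have := (cay_walk_powers n `|m - n|%N).2.
by have -> : n + `|m - n|%N = m by lia.
Qed.

End LampQuotient.

Lemma sat_le1 (R : realType) (S : choiceType) (w v : freegrp S) : sat R w v <= 1.
Proof.
rewrite /sat; have [->|v0] := posnP (size v); first by rewrite invr0 mulr0.
rewrite ler_pdivrMr ?ltr0n // mul1r ler_nat; apply/bigmax_leqP => j _.
by rewrite /ncovered (leq_trans (max_card _)) // card_ord size_rot.
Qed.

Lemma longest_piece_le (S : choiceType) (A : set (freegrp S)) (x : freegrp S) :
  (longest_piece A x <= size x)%N.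
Proof. by apply/bigmax_leqP => i _; rewrite -ltnS. Qed.

(** * The presentation *)

(* [r i] is the relator r_(i+1). *)
Theorem theorem1p6 (R : realType) (rho : nat -> nat)
    (rho_unbounded : forall M : nat, exists i, (M < rho i)%N) :
  exists r : nat -> freegrp abcd,
    let b := pgen r gen_b in
    [/\ small_cancellation_presentation (1 / 6 : R) r,
        forall m n : int, (cay_dist (expgz b m) (expgz b n))%:Z = `|m - n|,
        preceq (fun i => (longest_piece (symmetrized r) (r i))%:R
                           * sat R (fgen gen_b) (r i))
               (fun i => (rho i.+1)%:R)
      & ~ generalized_loxodromic R b].
Proof.
exists (fun i => relator (rho i.+1)); split.
- split=> [i|x y u xA yA xy ux uy].
    split; last exact: cyc_reduced_relator.
    by move=> r1; have := size_relator (rho i.+1); rewrite r1 addnC.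
  have := relators_small_cancellation xA yA xy ux uy.
  by rewrite -(ltr_nat R) natrM; lra.
- exact: (cay_dist_powers (fun i => rho i.+1)).
(* Bounding pieces by the relator and the saturation by 1 is enough, because the
   length of the relator is linear in rho. *)
- exists 192 => i; apply: (@le_trans _ _ (32 * (rho i.+1 + 6))%:R).
    rewrite -[leRHS]mulr1; apply: ler_pM; rewrite ?sat_le1 //.
      by rewrite /sat divr_ge0.
    by rewrite ler_nat (leq_trans (longest_piece_le _ _)) // size_relator.
  by rewrite natrM natrD; have := ler0n R (rho i.+1); lra.
- apply: (relators_not_generalized_loxodromic (f := fun i => rho i.+1)) => m.
  have [[|i] mi] := rho_unbounded (maxn m (rho 0)).
    by move: mi; rewrite gtn_max ltnn andbF.
  by exists i; move: mi; rewrite gtn_max => /andP[/ltnW].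
Qed.
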